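(* Let $P\subset\mathbb{R}^d$ be a $d$-dimensional smooth Fano polytope. Then $$d!\,\mathrm{vol}(P)\ \le\ 2\binom{\lfloor \frac52 d\rfloor}{2d}\ \approx\ 2\left(\frac{5^5}{4^4}\right)^{d/2}.$$
   Context: A convex lattice polytope in $\mathbb{R}^d$ is the convex hull of finitely many points of $\mathbb{Z}^d$. A $d$-dimensional convex lattice polytope $P\subset\mathbb{R}^d$ with the origin in its strict interior is called smooth Fano if the vertices of each facet of $P$ form a $\mathbb{Z}$-basis of $\mathbb{Z}^d$. $\mathrm{vol}(P)$ is the ordinary Euclidean $d$-dimensional volume. The symbol $\lfloor x\rfloor$ denotes the greatest integer not exceeding $x$. The symbol $\approx$ denotes an informal approximation of the binomial expression by the expression on the right; it is not given a more precise meaning in the statement. *)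

(* Defs.v *)
From mathcomp Require Import all_boot all_order all_algebra.
From mathcomp Require Import all_classical all_reals all_analysis.

Set Implicit Arguments.
Unset Strict Implicit.
Unset Printing Implicit Defensive.

Import Order.TTheory GRing.Theory Num.Theory.
Import numFieldNormedType.Exports.

Local Open Scope classical_set_scope.
Local Open Scope ring_scope.

Section Polytopes.
Context {R : realType}.

Definition lattice_point d (z : 'rV[int]_d) : 'rV[R]_d := map_mx intr z.

Definition conv_hull d n (p : 'I_n -> 'rV[R]_d) : set 'rV[R]_d :=
  [set x | exists c : 'I_n -> R,
    [/\ forall i, 0 <= c i, \sum_i c i = 1 & x = \sum_i c i *: p i]].

Definition lattice_polytope d (P : set 'rV[R]_d) : Prop :=
  exists n (z : 'I_n -> 'rV[int]_d),
    P = conv_hull (fun i => lattice_point (z i)).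

Definition affinely_independent d k (p : 'I_k -> 'rV[R]_d) : Prop :=
  forall c : 'I_k -> R,
    \sum_i c i = 0 -> \sum_i c i *: p i = 0 -> forall i, c i = 0.

(* [affine_rank A k]: the largest affinely independent families in [A] have
   [k] points, i.e. [A] has dimension [k - 1] (and [-1] if [A] is empty). *)
Definition affine_rank d (A : set 'rV[R]_d) (k : nat) : Prop :=
  (exists p : 'I_k -> 'rV[R]_d,
     (forall i, A (p i)) /\ affinely_independent p) /\
  (forall m (p : 'I_m -> 'rV[R]_d),
     (forall i, A (p i)) -> affinely_independent p -> (m <= k)%N).

Definition dot d (u x : 'rV[R]_d) : R := \sum_i u 0 i * x 0 i.

(* The inequality [dot u x <= c] may be trivial ([u = 0]), so that [P] and
   the empty set are faces of [P]. *)
Definition face d (P F : set 'rV[R]_d) : Prop :=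
  exists (u : 'rV[R]_d) (c : R),
    (forall x, P x -> dot u x <= c) /\ F = [set x | P x /\ dot u x = c].

(* Only used for [P] of full dimension [d], so that facets, the faces of
   dimension [d - 1], are those of affine rank [d]. *)
Definition facet d (P F : set 'rV[R]_d) : Prop :=
  face P F /\ affine_rank F d.

Definition vertices d (P : set 'rV[R]_d) : set 'rV[R]_d :=
  [set v | face P [set v]].

Definition Zbasis d (b : 'I_d -> 'rV[int]_d) : Prop :=
  forall z : 'rV[int]_d,
    exists! c : {ffun 'I_d -> int}, z = \sum_i c i *: b i.

Definition smooth_Fano_polytope d (P : set 'rV[R]_d) : Prop :=
  [/\ lattice_polytope P,
      affine_rank P d.+1,
      interior P 0
    & forall F, facet P F ->
        exists2 b : 'I_d -> 'rV[int]_d,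
          Zbasis b & vertices F = range (fun i => lattice_point (b i))].

Definition box d (a b : 'rV[R]_d) : set 'rV[R]_d :=
  [set x | forall i, a 0 i <= x 0 i <= b 0 i].

(* Lebesgue (outer) measure on [R^d]: the infimum of the total volumes of the
   coverings by at most countably many boxes.  The index set [D] allows
   finite coverings, which matters when [d = 0], where boxes have volume 1. *)
Definition vol d (A : set 'rV[R]_d) : \bar R :=
  ereal_inf [set v | exists (D : set nat) (a b : nat -> 'rV[R]_d),
    [/\ forall k, D k -> forall i, a k 0 i <= b k 0 i,
        A `<=` \bigcup_(k in D) box (a k) (b k)
      & v = \esum_(k in D) (\prod_i (b k 0 i - a k 0 i))%:E]].

(* [u d ~ v d]: the quotient is [1] up to a factor subexponential in [d]. *)
Definition approx_exp (u v : nat -> R) : Prop :=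
  (u d / v d) `^ (d%:R^-1) @[d --> \oo] --> (1 : R).

End Polytopes.

(* Main.v *)
Require Import Defs.
From mathcomp Require Import all_boot all_order all_algebra.
From mathcomp Require Import all_classical all_reals all_analysis.
From mathcomp Require Import ring lra zify.

(** Let [P] be a smooth Fano polytope and let [f] be its number of facets.

    _Volume_.  The cones over the facets cover the space, and a facet together
    with the origin spans a unimodular simplex, so [d! vol(P) <= f]
    ([factd_vol_le]).  No change of variables is needed: a cube of the grid
    [(1/n) Z^d] that meets [P] has its lowest corner in the slightly larger
    polytope [(1 + c/n) P], and the grid points there are, facet by facet,
    indexed by the vectors of [d] natural numbers with sum at most [n + c].
    Hence [f * 'C(d + n + c, d)] cubes of volume [n^-d] cover [P]; let [n] go
    to infinity.

    _Number of vertices_.  [P] has at most [3d] vertices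
    ([card_points_le]).  Among the facets choose one whose normal [u] is
    largest on the sum of all vertices.  As that sum lies in the cone over the
    facet, the values of [u] on the vertices have a nonnegative sum.  They are
    integers: [1] on the [d] vertices of the facet, at most [0] elsewhere.  The
    value [0] is taken at most [d] times, because smoothness forces such a
    vertex to lie on one of the [d] neighbouring facets; so a value [<= -1] is
    taken at most [d] times as well.

    _Number of facets_.  Fix a generic direction [g], and for a facet [T] let
    [R(T)] be the set of vertices of [T] on which [g], written in the basis
    [T], has a negative coordinate.  If [R(T)] is contained in another facet
    [T'], then the normal of [T'] is smaller on [g] than that of [T]
    ([neg_set_order]).  So, once the facets are sorted by the value of their
    normal on [g], the pairs formed by [R(T)] and the complement of [T] satisfy
    the hypotheses of the skew form of Bollobas' theorem, and at most
    [C(n - d + k, k)] facets have [#|R(T)| <= k], where [n] is the number of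
    vertices.  Replacing [g] by [- g] replaces [R(T)] by its complement in [T],
    and one of the two has at most [k = floor(d/2)] elements.  Therefore
    [f <= 2 C(n - d + k, k) <= 2 C(2d + k, k)], which is the stated bound.

    _Asymptotics_.  With [c = 5^5/4^4], comparing consecutive terms gives
    [c^k / (2k + 1) <= C(5k, k) <= c^k], and the polynomial factor disappears
    under the [d]-th root. *)

Set Implicit Arguments.
Unset Strict Implicit.
Unset Printing Implicit Defensive.

Import Order.TTheory GRing.Theory Num.Theory.
Import numFieldNormedType.Exports.

Local Open Scope ring_scope.

(** * The skew Bollobas theorem *)

(** Expanding the product exhibits the entries as values of a form of degree
    [b] in the [k + 1] variables [y j _]: the matrix factors through the
    monomials of that degree, which are the sorted [b]-tuples of variables. *)
Lemma rank_prod_dot (K : fieldType) (m r b k : nat)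
    (x : 'I_m -> 'I_b -> 'I_k.+1 -> K) (y : 'I_r -> 'I_k.+1 -> K)
    (M := \matrix_(i < m, j < r)
       \prod_(s < b) \sum_(l < k.+1) x i s l * y j l) :
  (\rank M <= 'C(b + k, k))%N.
Proof.
pose S := [set t : b.-tuple 'I_k.+1 | sorted leq (map val t)].
have cardS : #|S| = 'C(b + k, k).
  by rewrite card_sorted_tuples -[in RHS]bin_sub ?leq_addl // addnK.
pose le (u v : 'I_k.+1) := (u <= v)%N.
pose srt (phi : {ffun 'I_b -> 'I_k.+1}) : b.-tuple 'I_k.+1 :=
  [tuple of sort le [tuple phi s | s < b]].
have srtS phi : srt phi \in S.
  by rewrite inE sorted_map; apply: sort_sorted => u v; exact: leq_total.
pose C := \matrix_(i < m, a < #|S|)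
  \sum_(phi : {ffun 'I_b -> 'I_k.+1} | srt phi == enum_val a)
     \prod_(s < b) x i s (phi s).
pose X := \matrix_(a < #|S|, j < r) \prod_(l <- enum_val a : b.-tuple _) y j l.
rewrite -cardS; have -> : M = C *m X; last exact: mulmx_max_rank.
apply/matrixP => i j; rewrite !mxE bigA_distr_bigA /=.
rewrite (partition_big srt (mem S)) /=; last by move=> phi _; exact: srtS.
rewrite big_enum_val /=; apply: eq_bigr => a _.
rewrite !mxE mulr_suml; apply: eq_bigr => phi /eqP <-.
rewrite big_split /=; congr (_ * _).
rewrite [RHS](perm_big [tuple phi s | s < b]) /=; last by rewrite perm_sort.
by rewrite big_map big_enum.
Qed.

(** Place the elements of [V] at distinct rational points and let [q j] be the
    monic polynomial with the points of [A j] as roots.  The product of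
    [q j] over the points of [B i] vanishes exactly when [A j] meets [B i], so
    these products form a triangular matrix with nonzero diagonal.  Its rank
    [m] is bounded by [rank_prod_dot], evaluation of [q j] at a point being a
    scalar product with its [k + 1] coefficients. *)
Lemma skew_bollobas (V : finType) (m k b : nat) (A B : 'I_m -> {set V}) :
    (forall i, (#|A i| <= k)%N) -> (forall i, #|B i| = b) ->
    (forall i, [disjoint A i & B i]) ->
    (forall i j : 'I_m, (i < j)%N -> ~~ [disjoint A j & B i]) ->
  (m <= 'C(b + k, k))%N.
Proof.
move=> Ak Bb dAB skew.
pose e (v : V) : rat := (enum_rank v)%:R.
have e_inj : injective e.
  by move=> v w /eqP; rewrite eqr_nat => /eqP /val_inj /enum_rank_inj.
pose q j := \prod_(v in A j) ('X - (e v)%:P).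
have size_q j : (size (q j) <= k.+1)%N.
  by rewrite /q -big_enum size_prod_XsubC -cardE ltnS; exact: Ak.
have q_eq0 j w : ((q j).[e w] == 0) = (w \in A j).
  rewrite horner_prod; apply/prodf_eq0/idP => [[v Av]|Aw].
    by rewrite hornerXsubC subr_eq0 => /eqP/e_inj ->.
  by exists w => //; rewrite hornerXsubC subrr.
pose M := \matrix_(i < m, j < m) \prod_(w in B i) (q j).[e w].
have M_eq0 i j : (M i j == 0) = ~~ [disjoint A j & B i].
  rewrite mxE; apply/prodf_eq0/pred0Pn => [[w Bw]|[w]].
    by rewrite q_eq0 => Aw; exists w; rewrite /= Aw.
  by case/andP=> Aw Bw; exists w => //; rewrite q_eq0.
have M_unit : M \in unitmx.
  rewrite unitmxE det_trig.
    by rewrite unitfE; apply/prodf_neq0 => i _; rewrite M_eq0 dAB.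
  by apply/is_trig_mxP => i j ij; apply/eqP; rewrite M_eq0 skew.
rewrite -(mxrank_unit M_unit).
pose x i (s : 'I_b) (l : 'I_k.+1) :=
  e (enum_val (cast_ord (esym (Bb i)) s)) ^+ l.
pose y j (l : 'I_k.+1) := (q j)`_l.
have := rank_prod_dot x y; congr (\rank _ <= _)%N.
apply/matrixP => i j; rewrite !mxE [RHS]big_enum_val /=.
rewrite (reindex (cast_ord (esym (Bb i)))) /=; last first.
  by exists (cast_ord (Bb i)) => s _; rewrite ?cast_ordK ?cast_ordKV.
apply: eq_bigr => s _; rewrite (horner_coef_wide _ (size_q j)).
by apply: eq_bigr => l _; rewrite mulrC.
Qed.

(** A ranking [h], possibly with ties, is a convenient way to provide the order
    in which the skew condition holds: sort by decreasing [h]. *)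
Lemma skew_bollobas_ranked (R : realDomainType) (V F : finType) (k b : nat)
    (S : {set F}) (h : F -> R) (A B : F -> {set V}) :
    {in S, forall f, (#|A f| <= k)%N} -> {in S, forall f, #|B f| = b} ->
    {in S, forall f, [disjoint A f & B f]} ->
    {in S &, forall f g, f != g -> h g <= h f -> ~~ [disjoint A g & B f]} ->
  (#|S| <= 'C(b + k, k))%N.
Proof.
move=> Ak Bb dAB skew.
pose le f g := h g <= h f.
pose s := sort le (enum S).
have size_s : size s = #|S| by rewrite size_sort -cardE.
have mem_s f : (f \in s) = (f \in S) by rewrite mem_sort mem_enum.
pose t (i : 'I_#|S|) := tnth (in_tuple s) (cast_ord (esym size_s) i).
have tS i : t i \in S by rewrite -mem_s mem_tnth.
apply: (@skew_bollobas V #|S| k b (A \o t) (B \o t)) => /= [i|i|i|i j ij].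
- exact: Ak.
- exact: Bb.
- exact: dAB.
have [f0 _] : exists f0 : F, true by exists (t i).
have tE l : t l = nth f0 s l by rewrite /t (tnth_nth f0).
apply: skew => //.
  by rewrite !tE nth_uniq ?size_s ?sort_uniq ?enum_uniq // neq_ltn ij.
rewrite !tE; apply: (@sorted_leq_nth _ le) => //; rewrite ?inE ?size_s //.
- by move=> f g l fg lf; exact: le_trans lf fg.
- by move=> f; rewrite /le lexx.
- by apply: sort_sorted => f g; exact: le_total.
- exact: ltnW.
Qed.

Local Open Scope classical_set_scope.
Local Open Scope ring_scope.

(** * Scalar product *)

Section Dot.
Context {R : realType} {d : nat}.
Implicit Types u v x y : 'rV[R]_d.

Lemma dotC u x : dot u x = dot x u.
Proof. by apply: eq_bigr => i _; rewrite mulrC. Qed.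

Lemma dot_mul u x : dot u x = (x *m u^T) 0 0.
Proof. by rewrite mxE; apply: eq_bigr => i _; rewrite mxE mulrC. Qed.

Lemma dotDr u x y : dot u (x + y) = dot u x + dot u y.
Proof. by rewrite !dot_mul mulmxDl mxE. Qed.

Lemma dotZr u a x : dot u (a *: x) = a * dot u x.
Proof. by rewrite !dot_mul -scalemxAl mxE. Qed.

Lemma dotNr u x : dot u (- x) = - dot u x.
Proof. by rewrite -scaleN1r dotZr mulN1r. Qed.

Lemma dot0r u : dot u 0 = 0.
Proof. by rewrite -(scale0r 0) dotZr mul0r. Qed.

Lemma dot_sumr u (I : Type) (r : seq I) (P : pred I) (x : I -> 'rV[R]_d) :
  dot u (\sum_(i <- r | P i) x i) = \sum_(i <- r | P i) dot u (x i).
Proof. by apply: big_morph; [exact: dotDr | exact: dot0r]. Qed.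

Lemma dot_combr u (I : finType) (P : pred I) (c : I -> R) (x : I -> 'rV[R]_d) :
  dot u (\sum_(i | P i) c i *: x i) = \sum_(i | P i) c i * dot u (x i).
Proof. by rewrite dot_sumr; apply: eq_bigr => i _; rewrite dotZr. Qed.

Lemma dotDl u v x : dot (u + v) x = dot u x + dot v x.
Proof. by rewrite dotC dotDr !(dotC x). Qed.

Lemma dotZl u a x : dot (a *: u) x = a * dot u x.
Proof. by rewrite dotC dotZr dotC. Qed.

Lemma dotNl u x : dot (- u) x = - dot u x.
Proof. by rewrite dotC dotNr dotC. Qed.

Lemma dot_gt0 u : u != 0 -> 0 < dot u u.
Proof.
move=> u0; rewrite lt_def sumr_ge0 => [|i _]; last by rewrite -expr2 sqr_ge0.
rewrite andbT; apply: contra u0 => /eqP uu; apply/eqP/rowP => i.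
have /psumr_eq0P h : \sum_i u 0 i * u 0 i = 0 by [].
have /eqP : u 0 i * u 0 i = 0 by rewrite h // => j _; rewrite -expr2 sqr_ge0.
by rewrite mulf_eq0 orbb mxE => /eqP.
Qed.

(** On the moment curve [t |-> (1, t, t^2, ...)] each of the functionals [a i]
    restricts to a nonzero polynomial, so it vanishes at finitely many [t]. *)
Lemma avoid_hyperplanes (I : finType) (a : I -> 'rV[R]_d) :
  (forall i, a i != 0) -> exists g, forall i, dot (a i) g != 0.
Proof.
move=> a0; pose q := \prod_i rVpoly (a i).
have q0 : q != 0.
  apply/prodf_neq0 => i _; apply: contra (a0 i) => /eqP ai0.
  by rewrite -(rVpolyK (a i)) ai0 linear0.
have [t qt] : exists t : R, ~~ root q t.
  apply: contrapT => /forallNP all_root.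
  pose rs : seq R := [seq k%:R | k <- iota 0 (size q)].
  have := @max_poly_roots _ q rs q0; rewrite size_map size_iota ltnn.
  case/(_ _ _)/negP; last by [].
    by apply/allP => t _; apply/negPn/negP; exact: all_root.
  by rewrite map_inj_uniq ?iota_uniq // => k l /eqP; rewrite eqr_nat => /eqP.
exists (\row_i t ^+ i) => i.
have -> : dot (a i) (\row_i t ^+ i) = (rVpoly (a i)).[t].
  rewrite (horner_coef_wide _ (size_poly _ _)); apply: eq_bigr => j _.
  by rewrite mxE coef_rVpoly_ord.
by move: qt; rewrite /root horner_prod => /prodf_neq0; exact.
Qed.

End Dot.

(** * Fans of smooth polytopes *)

(** What the counting arguments use of a smooth Fano polytope with set of
    vertices [V] and set of facets [F]: the vertices [fvert f] of a facet, its
    normal [fnorm f] and the basis [fcoord f] dual to its vertices.  Everything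
    is linear algebra over this data; no convexity remains. *)
Record smooth_fan (R : realType) d (V F : finType) (p : V -> 'rV[int]_d) :=
  SmoothFan {
    fvert : F -> 'I_d -> V;
    fnorm : F -> 'rV[R]_d;
    fcoord : F -> 'I_d -> 'rV[R]_d;
    fvert_inj : forall f, injective (fvert f);
    facet_set_inj : forall f f', codom (fvert f) =i codom (fvert f') -> f = f';
    fnorm_le1 : forall f v, dot (fnorm f) (lattice_point (p v)) <= 1;
    fnorm_eq1 : forall f v, dot (fnorm f) (lattice_point (p v)) = 1 ->
      v \in codom (fvert f);
    fnorm_vert : forall f i, dot (fnorm f) (lattice_point (p (fvert f i))) = 1;
    fcoordK : forall f x,
      x = \sum_i dot (fcoord f i) x *: lattice_point (p (fvert f i));
    fcoord_neq0 : forall f i, fcoord f i != 0;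
    fcoord_int : forall f i z, dot (fcoord f i) (lattice_point z) \is a Num.int;
    fneighbour : forall f i, exists f',
      (forall j, j != i -> fvert f j \in codom (fvert f')) /\
      fvert f i \notin codom (fvert f');
    fpoint_neq0 : forall v, lattice_point (p v) != 0 :> 'rV[R]_d }.

Section SmoothFan.
Context (R : realType) (d : nat) (V F : finType) (p : V -> 'rV[int]_d).
Context (X : smooth_fan R F p).
Local Notation pt v := (lattice_point (R := R) (p v)).
Implicit Types (f : F) (v : V) (i j : 'I_d).

Definition facet_set f : {set V} := [set v in codom (fvert X f)].

Lemma card_facet_set f : #|facet_set f| = d.
Proof. by rewrite cardsE card_codom ?card_ord //; exact: fvert_inj. Qed.

Lemma fnorm_coord f x : dot (fnorm X f) x = \sum_i dot (fcoord X f i) x.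
Proof.
rewrite [in LHS](fcoordK X f x) dot_combr.
by apply: eq_bigr => i _; rewrite fnorm_vert mulr1.
Qed.

Lemma fnorm_eq1E f v : (dot (fnorm X f) (pt v) == 1) = (v \in facet_set f).
Proof.
rewrite inE; apply/eqP/idP => [/fnorm_eq1//|/codomP[i ->]].
exact: fnorm_vert.
Qed.

Lemma fnorm_int f v : dot (fnorm X f) (pt v) \is a Num.int.
Proof. by rewrite fnorm_coord rpred_sum // => i _; exact: fcoord_int. Qed.

Lemma fnorm_le0 f v : v \notin facet_set f -> dot (fnorm X f) (pt v) <= 0.
Proof.
rewrite -fnorm_eq1E => n1; have : dot (fnorm X f) (pt v) < 1.
  by rewrite lt_neqAle n1 fnorm_le1.
have /intrP[m ->] := fnorm_int f v.
by rewrite -[1]/(1%:~R) -[0]/(0%:~R) ltr_int ler_int; case: m => // -[].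
Qed.

(** Both sides agree on the basis formed by the vertices of [f]: the two normals
    differ by a multiple of the coordinate of the vertex that is left out. *)
Lemma fnorm_neighbour f i f' x :
    (forall j, j != i -> fvert X f j \in codom (fvert X f')) ->
  dot (fnorm X f') x =
  dot (fnorm X f) x
  + (dot (fnorm X f') (pt (fvert X f i)) - 1) * dot (fcoord X f i) x.
Proof.
move=> nb; rewrite [in LHS](fcoordK X f x) dot_combr (fnorm_coord f).
rewrite (bigD1 i) //= [in RHS](bigD1 i) //=.
rewrite (eq_bigr (fun j => dot (fcoord X f j) x)); first by ring.
move=> j ji; have /codomP[l ->] := nb j ji.
by rewrite fnorm_vert mulr1.
Qed.

(** If a coordinate of [x] were negative, the normal of the facet across the
    corresponding ridge would be larger on [x].  In particular, by finiteness
    of [F], every point lies in the cone over some facet. *)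
Lemma coord_ge0_of_max f x :
  (forall f', dot (fnorm X f') x <= dot (fnorm X f) x) ->
  forall i, 0 <= dot (fcoord X f i) x.
Proof.
move=> fmax i; rewrite leNgt; apply/negP => neg.
have [f' [nb new]] := fneighbour X f i.
have := fmax f'; rewrite (fnorm_neighbour x nb) gerDl leNgt => /negP; apply.
rewrite nmulr_lgt0 // subr_lt0; apply: le_lt_trans ltr01.
by apply: fnorm_le0; rewrite inE.
Qed.

Lemma level0_coord_lt0 f v :
  dot (fnorm X f) (pt v) = 0 -> exists i, dot (fcoord X f i) (pt v) < 0.
Proof.
move=> lvl0; apply: contrapT => /forallNP nneg.
have := fpoint_neq0 X v; rewrite (fcoordK X f (pt v)) big1 ?eqxx // => i _.
have /psumr_eq0P h : \sum_i dot (fcoord X f i) (pt v) = 0.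
  by rewrite -fnorm_coord.
by rewrite h ?scale0r // => j _; rewrite leNgt; apply/negP; exact: nneg.
Qed.

(** The two factors in [fnorm_neighbour] are negative integers, so the normal of
    the neighbour takes at [v] a value [>= 1], which is the largest possible. *)
Lemma level0_neighbour f i f' v :
    (forall j, j != i -> fvert X f j \in codom (fvert X f')) ->
    fvert X f i \notin codom (fvert X f') ->
    dot (fnorm X f) (pt v) = 0 -> dot (fcoord X f i) (pt v) < 0 ->
  v \in facet_set f'.
Proof.
move=> nb new lvl0 neg; rewrite -fnorm_eq1E eq_le fnorm_le1 /=.
rewrite (fnorm_neighbour _ nb) lvl0 add0r.
have n1 : dot (fcoord X f i) (pt v) <= -1.
  move: neg; have /intrP[m ->] := fcoord_int X f i (p v).
  by rewrite -[-1]/((-1)%:~R) -[0]/(0%:~R) ltr_int ler_int; case: m.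
have n2 : dot (fnorm X f') (pt (fvert X f i)) - 1 <= -1.
  by rewrite gerDr fnorm_le0 // inE.
by nra.
Qed.

Definition level0 f : {set V} := [set v | dot (fnorm X f) (pt v) == 0].

(** Each of the [d] neighbours contributes only one vertex outside [f]. *)
Lemma card_level0 f : (#|level0 f| <= d)%N.
Proof.
have [nb nbP] := choice (fneighbour X f).
pose N i := facet_set (nb i) :\: facet_set f.
have cardN i : (#|N i| <= 1)%N.
  have [old new] := nbP i.
  have sub :
      facet_set f :\ fvert X f i \subset facet_set (nb i) :&: facet_set f.
    apply/fintype.subsetP => v; rewrite finset.in_setD1 => /andP[vi vf].
    rewrite finset.in_setI vf andbT; move: vf vi; rewrite !inE.
    move=> /codomP[j ->] ji.
    by apply: old; apply: contra ji => /eqP ->.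
  have := subset_leq_card sub; have := cardsID (facet_set f) (facet_set (nb i)).
  have := cardsD1 (fvert X f i) (facet_set f).
  rewrite !card_facet_set inE codom_f.
  by rewrite -/(N i) /=; lia.
have cardU : (#|(\bigcup_i N i)%SET| <= \sum_(i < d) 1)%N.
  elim/big_ind2: _ => [|a A b B hA hB|i _]; first by rewrite cards0.
    by apply: leq_trans (leq_card_setU A B).1 _; exact: leq_add.
  exact: cardN.
rewrite sum1_card card_ord in cardU; apply: leq_trans cardU.
apply/subset_leq_card/fintype.subsetP => v; rewrite inE => /eqP lvl0.
have [i neg] := level0_coord_lt0 lvl0; have [old new] := nbP i.
apply/finset.bigcupP; exists i => //.
rewrite finset.in_setD -fnorm_eq1E lvl0 eq_sym oner_eq0.
exact: level0_neighbour neg.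
Qed.

Lemma exists_max_fnorm x : (0 < #|F|)%N ->
  exists f, forall f', dot (fnorm X f') x <= dot (fnorm X f) x.
Proof.
case/card_gt0P => f0 _; exists [arg max_(f > f0) dot (fnorm X f) x]%O.
by case: arg_maxP => // f _ fmax f'; exact: fmax.
Qed.

(** Casagrande's bound, by the argument with a special facet due to Obro. *)
Lemma card_points_le : (0 < #|F|)%N -> (#|V| <= 3 * d)%N.
Proof.
move=> F0; have [f fmax] := exists_max_fnorm (\sum_v pt v) F0.
have sum_ge0 : 0 <= dot (fnorm X f) (\sum_v pt v).
  by rewrite fnorm_coord sumr_ge0 // => i _; exact: coord_ge0_of_max.
pose N := ~: (facet_set f :|: level0 f).
have cardN : (#|N| <= d)%N.
  rewrite -(card_facet_set f) -(ler_nat R) -subr_ge0.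
  have cardE (A : {set V}) : #|A|%:R = \sum_v (v \in A)%:R :> R.
    rewrite -sum1_card natr_sum big_mkcond; apply: eq_bigr => v _.
    by case: (v \in A).
  (* Termwise: a value of the normal is at most [1] on the facet, at most [-1]
     on [N], and [0] at all other vertices. *)
  apply: le_trans sum_ge0 _; rewrite dot_sumr !cardE -sumrB.
  apply: ler_sum => v _.
  rewrite finset.in_setC finset.in_setU negb_or [v \in level0 f]inE.
  have [vf|vf] /= := boolP (v \in facet_set f).
    by rewrite subr0 fnorm_le1.
  have := fnorm_le0 vf; have [->|n0] /= := eqVneq; first by rewrite subr0.
  rewrite le_eqVlt (negbTE n0) /= sub0r.
  have /intrP[m ->] := fnorm_int f v.
  by rewrite -[- _]/((-1)%:~R) -[0]/(0%:~R) ltr_int ler_int; case: m.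
have := cardsC (facet_set f :|: level0 f).
have := (leq_card_setU (facet_set f) (level0 f)).1.
have := card_level0 f; rewrite -/N card_facet_set; lia.
Qed.

(** This is the restriction set of [f] in the shelling of the boundary complex
    by the direction [g]: for generic [g], the number of facets with
    [#|neg_set f g| = i] is the [i]-th entry of the [h]-vector. *)
Definition neg_set f g : {set V} :=
  [set fvert X f i | i in [pred i | dot (fcoord X f i) g < 0]].

Lemma neg_set_sub f g : neg_set f g \subset facet_set f.
Proof.
by apply/fintype.subsetP => v /imsetP[i _ ->]; rewrite inE codom_f.
Qed.

(** Expand [g] in the basis of vertices of [f] and apply the normal of [f'].  A
    negative coordinate belongs to a vertex of [f'], where the normal is [1]; a
    positive one gets multiplied by at most [1], and by at most [0] for a
    vertex of [f] that is not in [f']. *)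
Lemma neg_set_order f f' g : (forall i, dot (fcoord X f i) g != 0) ->
  neg_set f g \subset facet_set f' -> f != f' ->
  dot (fnorm X f') g < dot (fnorm X f) g.
Proof.
move=> gen sub ff'.
have [i i_new] : exists i, fvert X f i \notin facet_set f'.
  apply: contrapT => /forallNP all_in; case/negP: ff'; apply/eqP.
  suff /setP eqff' : facet_set f = facet_set f'.
    by apply: (@facet_set_inj _ _ _ _ _ X) => v; have := eqff' v; rewrite !inE.
  apply/eqP; rewrite eqEcard !card_facet_set leqnn andbT.
  apply/fintype.subsetP => v; rewrite inE => /codomP[i ->].
  by apply/negPn/negP; exact: all_in.
have term j : dot (fcoord X f j) g * dot (fnorm X f') (pt (fvert X f j))
    <= dot (fcoord X f j) g.
  have [neg|pos] := ltP (dot (fcoord X f j) g) 0.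
    have /eqP-> : dot (fnorm X f') (pt (fvert X f j)) == 1.
      rewrite fnorm_eq1E; apply: (fintype.subsetP sub).
      by apply/imsetP; exists j.
    by rewrite mulr1.
  by rewrite ler_piMr // fnorm_le1.
rewrite (fnorm_coord f) [in ltLHS](fcoordK X f g) dot_combr.
rewrite (bigD1 i) //= [ltRHS](bigD1 i) //= ltr_leD //; last exact: ler_sum.
rewrite -subr_gt0 -{1}[dot (fcoord X f i) g]mulr1 -mulrBr mulr_gt0 //.
  rewrite lt_def gen leNgt; apply: contra i_new => neg.
  by apply: (fintype.subsetP sub); apply/imsetP; exists i.
by rewrite subr_gt0; apply: le_lt_trans ltr01; exact: fnorm_le0.
Qed.

Definition small_neg g k : {set F} := [set f | (#|neg_set f g| <= k)%N].

(** The skew Bollobas theorem for the sets [neg_set f g] and the complements of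
    the facets, which have [#|V| - d] elements. *)
Lemma card_small_neg g k : (forall f i, dot (fcoord X f i) g != 0) ->
  (#|small_neg g k| <= 'C(#|V| - d + k, k))%N.
Proof.
move=> gen.
apply: (@skew_bollobas_ranked R V F k (#|V| - d)%N _
  (fun f => dot (fnorm X f) g) (neg_set^~ g) (fun f => ~: facet_set f)) => /=.
- by move=> f; rewrite inE.
- by move=> f _; rewrite -(cardsC (facet_set f)) card_facet_set addKn.
- by move=> f _; rewrite finset.disjoints_subset finset.setCK neg_set_sub.
move=> f f' _ _ ff' le_ff'; rewrite finset.disjoints_subset finset.setCK.
apply/negP => /(neg_set_order (gen f')).
by rewrite eq_sym => /(_ ff'); rewrite ltNge le_ff'.
Qed.

Lemma card_neg_setN f g : (forall i, dot (fcoord X f i) g != 0) ->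
  (#|neg_set f g| + #|neg_set f (- g)%R| = d)%N.
Proof.
move=> gen; rewrite !card_imset; try exact: fvert_inj.
rewrite -[RHS]card_ord -(cardC [pred i | dot (fcoord X f i) g < 0]).
congr addn; apply: eq_card => i; rewrite !inE dotNr oppr_lt0.
by rewrite -leNgt le_eqVlt eq_sym (negbTE (gen i)).
Qed.

(** For odd [d] this is the number of facets in the upper bound theorem for
    simplicial polytopes, for even [d] it is slightly larger.  Instead of the
    symmetry of the [h]-vector the proof uses the two directions [g] and [- g]:
    one of the two negative sets of a facet has at most [d / 2] elements. *)
Theorem card_facets_le_bin :
  (#|F| <= 2 * 'C(#|V| - d + d./2, d./2))%N.
Proof.
have [|g gen0] := @avoid_hyperplanes R d (F * 'I_d)%type
  (fun fi => fcoord X fi.1 fi.2); first by move=> [f i]; exact: fcoord_neq0.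
have gen f i : dot (fcoord X f i) g != 0 := gen0 (f, i).
have genN f i : dot (fcoord X f i) (- g) != 0 by rewrite dotNr oppr_eq0.
have cover : [set: F]%SET \subset small_neg g d./2 :|: small_neg (- g) d./2.
  apply/fintype.subsetP => f _; rewrite !inE.
  have := card_neg_setN (gen f).
  by have := odd_double_half d; lia.
rewrite -cardsT; apply: leq_trans (subset_leq_card cover) _.
apply: leq_trans (leq_card_setU _ _).1 _; rewrite mul2n -addnn.
by apply: leq_add; exact: card_small_neg.
Qed.

Lemma card_facets_le : (#|F| <= 2 * 'C((5 * d) %/ 2, 2 * d))%N.
Proof.
have [->//|F0] := posnP #|F|.
apply: leq_trans card_facets_le_bin _; rewrite leq_mul2l /=.
have -> : (5 * d %/ 2 = 2 * d + d./2)%N.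
  by rewrite -divn2; lia.
rewrite -[in leqRHS]bin_sub ?leq_addr // addKn.
by apply: leq_bin2l; rewrite leq_add2r leq_subLR -mulSn card_points_le.
Qed.

End SmoothFan.

(** * Dual bases and convex hulls *)

Section ZBasis.
Context {R : realType} {d : nat}.

Lemma Zbasis_dual (b : 'I_d -> 'rV[int]_d) : Zbasis b ->
  exists a : 'I_d -> 'rV[R]_d,
  [/\ forall x, x = \sum_i dot (a i) x *: lattice_point (b i),
      forall i j, dot (a i) (lattice_point (b j)) = (i == j)%:R
    & forall i z, dot (a i) (lattice_point z) \is a Num.int].
Proof.
move=> basis_b; pose B := \matrix_i b i.
have /choice[c cP] (i : 'I_d) : exists c : 'rV[int]_d, delta_mx 0 i = c *m B.
  have [c [cE _]] := basis_b (delta_mx 0 i); exists (\row_j c j).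
  by rewrite cE mulmx_sum_row; apply: eq_bigr => j _; rewrite mxE rowK.
pose C := \matrix_i c i.
have CB : C *m B = 1%:M.
  by apply/row_matrixP => i; rewrite row_mul rowK -cP row1.
have BC := mulmx1C CB.
pose CR : 'M[R]_d := map_mx intr C.
exists (fun i => (col i CR)^T).
have dotE i x : dot (col i CR)^T x = (x *m CR) 0 i.
  by rewrite mxE; apply: eq_bigr => k _; rewrite !mxE mulrC.
have BE : \matrix_i lattice_point (b i) = map_mx intr B :> 'M[R]_d.
  by apply/matrixP => i j; rewrite !mxE.
split=> [x|i j|i z].
- rewrite -[LHS]mulmx1 -(map_mx1 intr) -CB map_mxM mulmxA -BE mulmx_sum_row.
  by apply: eq_bigr => i _; rewrite rowK dotE.
- rewrite dotE -map_mxM; have -> : b j *m C = row j (B *m C).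
    by rewrite row_mul rowK.
  by rewrite BC !mxE eq_sym; case: eqP.
- by rewrite dotE -map_mxM mxE; apply/intrP; eexists.
Qed.

End ZBasis.

Section Hull.
Context {R : realType} {d N : nat} (p : 'I_N -> 'rV[R]_d).
Local Notation P := (conv_hull p).
Implicit Types (u w x : 'rV[R]_d).

Lemma hull_gen i : P (p i).
Proof.
exists (fun j => (j == i)%:R); split=> [j||].
- exact: ler0n.
- by rewrite (bigD1 i) //= eqxx big1 ?addr0 // => j /negbTE ->.
- rewrite (bigD1 i) //= eqxx scale1r big1 ?addr0 // => j /negbTE ->.
  by rewrite scale0r.
Qed.

(** The slack of a convex combination is the weighted sum of the slacks of the
    points, none of which is negative. *)
Lemma hull_support u m (c : 'I_N -> R) :
    (forall i, 0 <= c i) -> \sum_i c i = 1 ->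
    (forall i, 0 < c i -> dot u (p i) <= m) ->
  dot u (\sum_i c i *: p i) <= m
    ?= iff [forall (i | 0 < c i), dot u (p i) == m].
Proof.
move=> c0 c1 le_m.
have slack i : 0 <= c i * (m - dot u (p i)).
  have := c0 i; rewrite le_eqVlt => /predU1P[<-|ci]; first by rewrite mul0r.
  by rewrite mulr_ge0 // subr_ge0 le_m.
have slackE : m - dot u (\sum_i c i *: p i) = \sum_i c i * (m - dot u (p i)).
  rewrite dot_combr -{1}[m]mul1r -c1 mulr_suml -sumrB.
  by apply: eq_bigr => i _; rewrite mulrBr.
split; first by rewrite -subr_ge0 slackE sumr_ge0.
rewrite eq_sym -subr_eq0 slackE psumr_eq0; last by move=> i _; exact: slack.
apply/allP/forall_inP => [all0 i ci|all_m i _].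
  have := all0 i (mem_index_enum i); rewrite /= mulf_eq0 gt_eqF //= subr_eq0.
  by rewrite eq_sym.
rewrite implyTb mulf_eq0; have := c0 i.
rewrite le_eqVlt => /predU1P[<-|/all_m/eqP ->]; first by rewrite eqxx.
by rewrite subrr eqxx orbT.
Qed.

Lemma hull_le u m x : (forall i, dot u (p i) <= m) -> P x -> dot u x <= m.
Proof.
move=> le_m [c [c0 c1 ->]].
exact: (hull_support c0 c1 (fun i _ => le_m i)).1.
Qed.

Lemma sum1_pos (c : 'I_N -> R) :
  (forall i, 0 <= c i) -> \sum_i c i = 1 -> exists i, 0 < c i.
Proof.
move=> c0 c1; apply: contrapT => /forallNP npos.
have : (0 : R) = 1; last by move/eqP; rewrite eq_sym oner_eq0.
rewrite -c1 big1 // => i _; apply/eqP; rewrite eq_le c0 andbT leNgt.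
by apply/negP; exact: npos.
Qed.

(** For a large factor [M] the functional [M u + w] orders the generators
    lexicographically, first by [u]; ties are then broken by [w].  This is how
    faces of faces are recognized as faces. *)
Lemma lexicographic u w : exists M, forall i j,
  dot u (p i) < dot u (p j) -> dot (M *: u + w) (p i) < dot (M *: u + w) (p j).
Proof.
pose term i j := `|(dot w (p i) - dot w (p j)) / (dot u (p j) - dot u (p i))|.
exists (1 + \sum_i \sum_j term i j) => i j lt_ij.
have le_term : term i j <= \sum_i \sum_j term i j.
  rewrite (bigD1 i) //= (bigD1 j) //= -addrA lerDl addr_ge0 //.
    by apply: sumr_ge0 => k _; exact: normr_ge0.
  by do 2!apply: sumr_ge0 => ? _; exact: normr_ge0.
have pos : 0 < dot u (p j) - dot u (p i) by rewrite subr_gt0.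
have lt_M : (dot w (p i) - dot w (p j)) / (dot u (p j) - dot u (p i))
    < 1 + \sum_i \sum_j term i j.
  apply: le_lt_trans (ler_norm _) _; apply: le_lt_trans le_term _.
  by rewrite ltrDr.
by move: lt_M; rewrite ltr_pdivrMr // !dotDl !dotZl; lra.
Qed.

Definition exposed x :=
  exists w, forall i, p i != x -> dot w (p i) < dot w x.

(** Ties among the maximizers of [u] are broken by a functional that separates
    distinct generators. *)
Lemma exposed_max (i0 : 'I_N) u : exists2 i, exposed (p i) &
  forall k, dot u (p k) <= dot u (p i).
Proof.
pose I := {ij : 'I_N * 'I_N | p ij.1 != p ij.2}.
have [|w gen] := @avoid_hyperplanes R d I
  (fun ij => p (val ij).1 - p (val ij).2).
  by move=> [[i j] /= ij]; rewrite subr_eq0.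
have {}gen i j : p i != p j -> dot w (p i) != dot w (p j).
  move=> ij; have := gen (Sub (i, j) ij); rewrite dotC dotDr dotNr subr_eq0.
  exact.
have [M lex] := lexicographic u w.
pose i := [arg max_(i > i0) dot (M *: u + w) (p i)]%O.
have maxi k : dot (M *: u + w) (p k) <= dot (M *: u + w) (p i).
  by rewrite /i; case: arg_maxP => // j _; apply.
have maxu k : dot u (p k) <= dot u (p i).
  by rewrite leNgt; apply/negP => /lex; rewrite ltNge maxi.
exists i => //; exists (M *: u + w) => k ki.
have := maxu k; rewrite le_eqVlt => /predU1P[eq_u|/lex//].
rewrite lt_neqAle maxi andbT !dotDl !dotZl eq_u.
by rewrite (inj_eq (addrI _)) gen.
Qed.

(** As the origin is interior, every facet can be cut out by an equation with
    right-hand side [1]. *)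
Definition slice u : set 'rV[R]_d := [set x | P x /\ dot u x = 1].

Definition supporting u := forall i, dot u (p i) <= 1.

(** If [w] exposes a vertex of the face, then [M u + w] exposes it among all the
    generators, for large [M]. *)
Lemma vertices_slice u x : supporting u ->
  vertices (slice u) x <-> exists i, [/\ x = p i, exposed x & dot u x = 1].
Proof.
move=> supp_u; split; last first.
  case=> i [xi [w wP] ux]; exists w, (dot w x); split.
    move=> y [Py _]; apply: hull_le Py => k.
    by have [->//|/wP/ltW] := eqVneq (p k) x.
  apply/seteqP; split=> [y ->|y [[Py _] wy]].
    by split=> //; split=> //; rewrite xi; exact: hull_gen.
  case: Py => c [c0 c1 yE]; rewrite /= -[RHS]scale1r -c1 scaler_suml.
  have le_m k : 0 < c k -> dot w (p k) <= dot w x.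
    by move=> _; have [->//|/wP/ltW] := eqVneq (p k) x.
  have [_] := hull_support c0 c1 le_m.
  rewrite -yE wy eqxx => /esym/forall_inP eqm; rewrite yE.
  apply: eq_bigr => k _; have := c0 k; rewrite le_eqVlt => /predU1P[<-|ck].
    by rewrite !scale0r.
  have [->//|/wP] := eqVneq (p k) x.
  by rewrite (eqP (eqm k ck)) ltxx.
case=> w [m [le_m sx]].
have [[[c [c0 c1 xE]] ux] wx] : slice u x /\ dot w x = m.
  by have : [set x] x by []; rewrite sx.
have tight k : 0 < c k -> dot u (p k) = 1.
  have [_] := hull_support c0 c1 (fun k _ => supp_u k).
  by rewrite -xE ux eqxx => /esym/forall_inP h /h/eqP.
have wm k : 0 < c k -> dot w (p k) = m.
  have h k' : 0 < c k' -> dot w (p k') <= m.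
    by move=> /tight uk; apply: le_m; split=> //; exact: hull_gen.
  have [_] := hull_support c0 c1 h.
  by rewrite -xE wx eqxx => /esym/forall_inP h' /h'/eqP.
have only k : dot u (p k) = 1 -> dot w (p k) = m -> p k = x.
  move=> uk wk; have : (slice u `&` [set y | dot w y = m]) (p k); last first.
    by rewrite (_ : _ `&` _ = [set x]) // sx; apply/seteqP; split=> y [].
  by split=> //; split=> //; exact: hull_gen.
have [i ci] := sum1_pos c0 c1.
have pix := only i (tight i ci) (wm i ci).
exists i; split=> //; have [M lex] := lexicographic u w.
exists (M *: u + w) => k kx; have := supp_u k.
rewrite le_eqVlt => /predU1P[uk|uk]; last by rewrite -pix lex // pix ux.
rewrite !dotDl !dotZl uk ux ltrD2l wx lt_neqAle; apply/andP; split.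
  by apply: contra kx => /eqP wk; apply/eqP; exact: only.
by apply: le_m; split=> //; exact: hull_gen.
Qed.

Definition facet_normal u := supporting u /\ exists y : 'I_d -> 'rV[R]_d,
  (forall k, (exists i, y k = p i) /\ dot u (y k) = 1) /\
  \matrix_k y k \in unitmx.

Lemma comb_row m (c : 'I_m -> R) (y : 'I_m -> 'rV[R]_d) :
  \sum_k c k *: y k = (\row_k c k) *m \matrix_k y k.
Proof. by rewrite mulmx_sum_row; apply: eq_bigr => k _; rewrite mxE rowK. Qed.

Lemma facet_slice u : facet_normal u -> facet P (slice u).
Proof.
move=> [supp_u [y [yP y_unit]]]; split.
  by exists u, 1; split=> // x; exact: hull_le.
split.
  exists y; split=> [k|c _].
    by have [[i ->] uy] := yP k; split=> //; exact: hull_gen.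
  rewrite comb_row => /(canRL (mulmxK y_unit)); rewrite mul0mx => /rowP c0 k.
  by have := c0 k; rewrite !mxE.
move=> m q qP q_indep.
have : row_free (\matrix_k q k); last first.
  by rewrite -row_leq_rank => /leq_trans; apply; exact: rank_leq_col.
apply: inj_row_free => v vq0.
have sum0 : \sum_k v 0 k *: q k = 0.
  rewrite -[RHS]vq0 mulmx_sum_row; by apply: eq_bigr => k _; rewrite rowK.
apply/rowP => k; rewrite mxE; apply: (q_indep (fun k => v 0 k)) => //.
have := congr1 (dot u) sum0; rewrite dot_combr dot0r => dot_sum0.
rewrite -[RHS]dot_sum0; apply: eq_bigr => j _.
by have [_ ->] := qP j; rewrite mulr1.
Qed.

(** Rotate a supporting hyperplane in the direction [w] until it meets a
    generator on the side where [w] is positive: the first contact is found by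
    the ratio test of the simplex method. *)
Lemma push u w : supporting u -> (exists i, 0 < dot w (p i)) ->
  exists t i, [/\ 0 <= t, supporting (u + t *: w),
    dot (u + t *: w) (p i) = 1 & 0 < dot w (p i)].
Proof.
move=> supp_u [i0 w0].
pose ratio i := (1 - dot u (p i)) / dot w (p i).
pose i := [arg min_(i < i0 | 0 < dot w (p i)) ratio i]%O.
have [wi mini] : 0 < dot w (p i) /\
    forall k, 0 < dot w (p k) -> ratio i <= ratio k.
  by rewrite /i; case: arg_minP.
exists (ratio i), i.
have ri0 : 0 <= ratio i by rewrite divr_ge0 ?(ltW wi) // subr_ge0.
split=> //; last by rewrite dotDl dotZl divfK ?gt_eqF // addrC subrK.
move=> k; rewrite dotDl dotZl; have [wk|wk] := ltP 0 (dot w (p k)).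
  rewrite -lerBrDl -ler_pdivlMr //; exact: mini.
by rewrite -[leRHS]addr0 lerD ?supp_u // mulr_ge0_le0.
Qed.

(** The dual form of the origin being an interior point of the hull. *)
Definition origin_inside := forall w, w != 0 -> exists i, 0 < dot w (p i).

(** While the generators on a supporting hyperplane do not span, the hyperplane
    can be rotated around them until it meets one outside their span. *)
Lemma exists_facet_normal : 'I_N -> origin_inside -> exists u, facet_normal u.
Proof.
move=> i0 int0.
pose indep k (y : nat -> 'rV[R]_d) := forall c : nat -> R,
  \sum_(j < k) c j *: y j = 0 -> forall j, (j < k)%N -> c j = 0.
have grow k : (k <= d)%N -> exists u y, [/\ supporting u,
      forall j, (j < k)%N -> (exists i, y j = p i) /\ dot u (y j) = 1
    & indep k y].
  elim: k => [_|k IH lt_kd].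
    exists 0, (fun=> 0); split=> // i.
    by rewrite dotC dot0r ler01.
  have [u [y [supp_u yP y_indep]]] := IH (ltnW lt_kd).
  have [w w0 yw] : exists2 w, w != 0 & forall j, (j < k)%N -> dot w (y j) = 0.
    pose A := \matrix_(j < k) y j.
    have : kermx A^T != 0.
      rewrite -mxrank_eq0 mxrank_ker subn_eq0 -ltnNge.
      exact: leq_ltn_trans (rank_leq_col _) lt_kd.
    case/rowV0Pn => w /sub_kermxP wA w0; exists w => // j lt_jk.
    have /rowP/(_ (Ordinal lt_jk)) := wA; rewrite !mxE => <-.
    by apply: eq_bigr => l _; rewrite !mxE.
  have [t [i [t0 supp_t ti wi]]] := push supp_u (int0 w w0).
  exists (u + t *: w), (fun j => if j == k then p i else y j); split=> //.
    move=> j; rewrite ltnS leq_eqVlt => /predU1P[->|lt_jk].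
      by rewrite eqxx; split=> //; exists i.
    rewrite ltn_eqF //; have [yj uy] := yP j lt_jk; split=> //.
    by rewrite dotDl dotZl uy yw // mulr0 addr0.
  move=> c; rewrite big_ord_recr /= eqxx.
  rewrite (eq_bigr (fun j : 'I_k => c j *: y j)); last first.
    by move=> j _; rewrite ltn_eqF.
  move=> c0; have ck : c k = 0.
    have := congr1 (dot w) c0; rewrite dotDr dot0r dot_combr big1 ?add0r.
      by rewrite dotZr => /eqP; rewrite mulf_eq0 (gt_eqF wi) orbF => /eqP.
    by move=> j _; rewrite yw ?mulr0.
  move: c0; rewrite ck scale0r addr0 => /y_indep c0 j.
  by rewrite ltnS leq_eqVlt => /predU1P[->//|/c0].
have [u [y [supp_u yP y_indep]]] := grow d (leqnn d).
exists u; split=> //; exists (fun j => y j); split=> [k|]; first exact: yP.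
rewrite -row_free_unit; apply: inj_row_free => v vy0; apply/rowP => k.
rewrite mxE; have := y_indep (fun j => oapp (v 0) 0 (insub j)) _ k (ltn_ord k).
rewrite valK /=; apply; rewrite -[RHS]vy0 mulmx_sum_row.
by apply: eq_bigr => j _; rewrite valK rowK.
Qed.

End Hull.

(** * The fan of a smooth Fano polytope *)

Section Frames.
Context {R : realType} {d N : nat} (z : 'I_N -> 'rV[int]_d).
Local Notation p := (fun i => lattice_point (R := R) (z i)).

(** The last clause says that the points [b] are the vertices of the facet
    with normal [u], in the form given by [vertices_slice]. *)
Definition facet_frame (u : 'rV[R]_d) (b : 'I_d -> 'rV[int]_d)
    (a : 'I_d -> 'rV[R]_d) :=
  [/\ forall x, x = \sum_i dot (a i) x *: lattice_point (b i),
      forall i j, dot (a i) (lattice_point (b j)) = (i == j)%:R,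
      forall i y, dot (a i) (lattice_point y) \is a Num.int
    & forall x, (exists i, lattice_point (b i) = x) <->
        exists i, [/\ x = p i, exposed p x & dot u x = 1]].

Lemma smooth_facet_frame u :
    (forall F, facet (conv_hull p) F ->
       exists2 b : 'I_d -> 'rV[int]_d, Zbasis b
       & vertices F = range (fun i => lattice_point (b i))) ->
    facet_normal p u ->
  exists b a, facet_frame u b a.
Proof.
move=> smooth norm_u; have [b basis_b vertE] := smooth _ (facet_slice norm_u).
have [a [aK ab aint]] := @Zbasis_dual R d b basis_b.
exists b, a; split=> // x; rewrite -vertices_slice; last by case: norm_u.
rewrite vertE; split; first by case=> i <-; exists i.
by case=> i _ <-; exists i.
Qed.

Section Frame.
Context (u : 'rV[R]_d) (b : 'I_d -> 'rV[int]_d) (a : 'I_d -> 'rV[R]_d).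
Context (supp_u : supporting p u) (frame : facet_frame u b a).

Lemma frame_tight i : dot u (lattice_point (b i)) = 1.
Proof.
case: frame => _ _ _ vert.
by have /vert[k []] : exists j, lattice_point (b j) = lattice_point (b i)
  :> 'rV[R]_d by exists i.
Qed.

(** A functional is minimal on a facet at one of its vertices, and there the
    coordinate [a i] takes only the values [0] and [1]. *)
Lemma frame_coord_ge0 i k : dot u (p k) = 1 -> 0 <= dot (a i) (p k).
Proof.
move=> uk; case: frame => _ ab _ vert.
have [M lex] := lexicographic p u (- a i).
have [j expj maxj] := exposed_max p k (M *: u - a i).
have uj : dot u (p j) = 1.
  apply/eqP; rewrite eq_le supp_u /= -uk leNgt; apply/negP => /lex.
  by rewrite ltNge maxj.
have [l bl] : exists l, lattice_point (b l) = p j by apply/vert; exists j.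
have := maxj k; rewrite !dotDl !dotZl uk uj lerD2l !dotNl lerN2.
by rewrite -bl ab; apply: le_trans; exact: ler0n.
Qed.

(** Pushing the normal along [- a i] keeps the other vertices [b j] on the
    hyperplane.  The push is a proper one by [frame_coord_ge0], and the
    generator [p k] that is reached replaces [b i] in the basis, its [i]-th
    coordinate being nonzero. *)
Lemma frame_neighbour i : origin_inside p -> exists u',
  [/\ facet_normal p u', forall j, j != i -> dot u' (lattice_point (b j)) = 1
    & dot u' (lattice_point (b i)) != 1].
Proof.
move=> int0; case: frame => _ ab _ vert.
have ai0 : - a i != 0.
  apply/negP => /eqP ai0; have := ab i i.
  rewrite -[a i]opprK ai0 oppr0 dotC dot0r eqxx => /eqP.
  by rewrite eq_sym oner_eq0.
have [t [k [t0 supp_t tk ak]]] := push supp_u (int0 _ ai0).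
move: ak; rewrite dotNl oppr_gt0 => ak.
have {}t0 : 0 < t.
  rewrite lt_def t0 andbT; apply/eqP => t00; move: tk.
  by rewrite t00 scale0r addr0 => /(frame_coord_ge0 i); rewrite leNgt ak.
have tE j : dot (u + t *: - a i) (lattice_point (b j)) = 1 - t * (i == j)%:R.
  by rewrite dotDl dotZl dotNl ab frame_tight mulrN.
exists (u + t *: - a i); split; last first.
- by rewrite tE eqxx mulr1 -subr_eq0 addrAC subrr add0r oppr_eq0 gt_eqF.
- by move=> j ji; rewrite tE eq_sym (negbTE ji) mulr0 subr0.
split=> //; exists (fun j => if j == i then p k else lattice_point (b j)).
split=> [j|].
  have [_|ji] := eqVneq j i; first by split=> //; exists k.
  split; last by rewrite tE eq_sym (negbTE ji) mulr0 subr0.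
  have /vert[l [-> _ _]] : exists j', lattice_point (b j') = lattice_point (b j)
    :> 'rV[R]_d by exists j.
  by exists l.
rewrite -row_free_unit; apply: inj_row_free => v.
rewrite mulmx_sum_row => sum0.
have coord l : v 0 i * dot (a l) (p k) + (l != i)%:R * v 0 l = 0.
  have := congr1 (dot (a l)) sum0.
  rewrite dot_combr dot0r (bigD1 i) //= rowK eqxx.
  move=> <-; congr (_ + _); have [->|li] := eqVneq l i.
    rewrite mul0r big1 // => j ji.
    by rewrite rowK (negbTE ji) ab eq_sym (negbTE ji) mulr0.
  rewrite mul1r (bigD1 l) //= rowK (negbTE li) ab eqxx mulr1 big1 ?addr0 //.
  move=> j /andP[ji jl].
  by rewrite rowK (negbTE ji) ab eq_sym (negbTE jl) mulr0.
have vi : v 0 i = 0.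
  have := coord i; rewrite eqxx mul0r addr0 => /eqP.
  by rewrite mulf_eq0 (lt_eqF ak) orbF => /eqP.
apply/rowP => l; rewrite mxE; have [->//|li] := eqVneq l i.
by have := coord l; rewrite vi mul0r add0r li mul1r.
Qed.

End Frame.

Lemma origin_insideP : interior (conv_hull p) 0 -> origin_inside p.
Proof.
move=> int0 w w0; apply: contrapT => /forallNP nonpos.
have : \forall t \near (0 : R), conv_hull p (t *: w).
  apply: (@scalel_continuous _ _ w 0).
  by rewrite scale0r.
move=> /nbhs_ballP[e /= e0 sub].
have : conv_hull p ((e / 2) *: w).
  apply: sub; rewrite /ball /= sub0r normrN gtr0_norm ?divr_gt0 //.
  by rewrite ltr_pdivrMr // ltr_pMr // ltr1n.
have le0 i : dot w (p i) <= 0 by rewrite leNgt; apply/negP; exact: nonpos.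
by move/(hull_le le0); rewrite dotZr leNgt mulr_gt0 ?divr_gt0 ?dot_gt0.
Qed.

End Frames.

(** The points of the fan are the exposed generators, and its facets are the
    sets of points cut out by facet normals.  The origin has to be excluded
    from the points because for [d = 0] it is a vertex of [P]. *)
Theorem fan_of_smooth_Fano (R : realType) d (P : set 'rV[R]_d) :
  smooth_Fano_polytope P -> exists (V F : finType) (p : V -> 'rV[int]_d)
    (X : smooth_fan R F p), (0 < #|F|)%N /\
      forall f x, P x -> dot (fnorm X f) x <= 1.
Proof.
case=> [[N [z PE]] _ int0 smooth]; rewrite {}PE in int0 smooth *.
pose p i : 'rV[R]_d := lattice_point (z i); rewrite -/p in int0 smooth *.
have int_p := origin_insideP int0.
have [c [c0 c1 _]] : conv_hull p 0 by exact: interior_subset.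
have [i0 _] := sum1_pos c0 c1.
pose vs := [seq y <- undup (codom z) |
  `[< exposed p (lattice_point y) >] && (y != 0)].
pose V : finType := seq_sub vs.
pose pt (v : V) : 'rV[R]_d := lattice_point (val v).
pose tight u : {set V} := [set v : V | dot u (pt v) == 1]%SET.
pose F : finType :=
  {T : {set V} | `[< exists2 u, facet_normal p u & T = tight u >]}.
have /choice[u uP] (f : F) : exists u, facet_normal p u /\ val f = tight u.
  by case: f => T /= /asboolP[u nu ->]; exists u.
have /choice[b bP] (f : F) : exists b, exists a, facet_frame z (u f) b a.
  by apply: smooth_facet_frame => //; have [] := uP f.
have /choice[a frame] := bP.
have supp f : supporting p (u f) by have [[]] := uP f.
have lattice0 : lattice_point 0 = 0 :> 'rV[R]_d.
  by apply/rowP => j; rewrite !mxE.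
have lattice_inj : injective (@lattice_point R d).
  move=> y y' /rowP yy'; apply/rowP => j; have := yy' j.
  by rewrite !mxE => /intr_inj.
have b_vs f i : b f i \in vs.
  have [_ _ _ vert] := frame f.
  have /vert[k [bk expk ubk]] : exists j, lattice_point (b f j) =
    lattice_point (b f i) :> 'rV[R]_d by exists i.
  rewrite mem_filter mem_undup (lattice_inj _ _ bk) codom_f andbT.
  rewrite -(lattice_inj _ _ bk); apply/andP; split; first exact/asboolP.
  apply: contraTneq isT => bi0; move: ubk; rewrite bi0 lattice0 dot0r => /eqP.
  by rewrite eq_sym oner_eq0.
pose vert f i : V := SeqSub (b_vs f i).
have tightE f v : (v \in codom (vert f)) = (dot (u f) (pt v) == 1).
  apply/codomP/eqP => [[i ->]|uv]; first exact: (frame_tight (frame f)).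
  have [_ _ _ vertP] := frame f.
  have := valP v; rewrite mem_filter mem_undup => /andP[/andP[/asboolP expv _]].
  case/codomP=> k vk.
  have /vertP[i bi] : exists i,
      [/\ pt v = p i, exposed p (pt v) & dot (u f) (pt v) = 1].
    by exists k; split=> //; rewrite /pt vk.
  by exists i; apply/val_inj/esym/lattice_inj.
have mem_val (f : F) (v : V) : (v \in val f) = (v \in codom (vert f)).
  by have [_ ->] := uP f; rewrite inE tightE.
have add_facet u' : facet_normal p u' -> exists f, forall v,
    (v \in codom (vert f)) = (dot u' (pt v) == 1).
  move=> nu'; have FT : `[< exists2 u, facet_normal p u & tight u' = tight u >].
    by apply/asboolP; exists u'.
  by exists (Sub (tight u') FT : F) => v; rewrite -mem_val /= inE.
have vert_inj f : injective (vert f).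
  move=> i j /(congr1 (fun v : V => dot (a f i) (pt v))).
  have [_ ab _ _] := frame f; rewrite /pt /= !ab eqxx.
  by have [->//|_ /eqP] := eqVneq i j; rewrite oner_eq0.
have set_inj f f' : codom (vert f) =i codom (vert f') -> f = f'.
  by move=> ff'; apply: val_inj; apply/setP => v; rewrite !mem_val.
have le1 f v : dot (u f) (pt v) <= 1.
  have := valP v; rewrite mem_filter mem_undup => /andP[_ /codomP[k vk]].
  rewrite /pt vk. exact: supp.
have eq1 f v : dot (u f) (pt v) = 1 -> v \in codom (vert f).
  by move=> uv; rewrite tightE uv eqxx.
have vert1 f i : dot (u f) (pt (vert f i)) = 1 by exact: frame_tight.
have coordK f x : x = \sum_i dot (a f i) x *: pt (vert f i).
  by have [aK _ _ _] := frame f; exact: aK.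
have coord_neq0 f i : a f i != 0.
  have [_ ab _ _] := frame f; apply/eqP => a0; have := ab i i.
  by rewrite a0 dotC dot0r eqxx => /eqP; rewrite eq_sym oner_eq0.
have coord_int f i y : dot (a f i) (lattice_point y) \is a Num.int.
  by have [_ _ aint _] := frame f; exact: aint.
have neighbour f i : exists f',
    (forall j, j != i -> vert f j \in codom (vert f')) /\
    vert f i \notin codom (vert f').
  have [u' [nu' old new]] := frame_neighbour (supp f) (frame f) i int_p.
  have [f' f'E] := add_facet u' nu'; exists f'; split=> [j ji|].
    by rewrite f'E /pt /= old.
  by rewrite f'E.
have pt_neq0 v : pt v != 0.
  have := valP v; rewrite mem_filter => /andP[/andP[_ v0] _].
  by apply: contra v0 => /eqP; rewrite -lattice0 => /lattice_inj ->.
exists V, F, (fun v => val v), (SmoothFan vert_inj set_inj le1 eq1 vert1 coordK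
  coord_neq0 coord_int neighbour pt_neq0); split=> [|f x Px /=].
  have [u0 nu0] := exists_facet_normal i0 int_p.
  by have [f _] := add_facet u0 nu0; apply/card_gt0P; exists f.
exact: hull_le (supp f) Px.
Qed.

(** * The volume is bounded by the number of facets *)

Lemma vol_le_cover (R : realType) d (A : set 'rV[R]_d) (I : finType)
    (a b : I -> 'rV[R]_d) :
    (forall i j, a i 0 j <= b i 0 j) ->
    (forall x, A x -> exists i, box (a i) (b i) x) ->
  (vol A <= (\sum_i \prod_j (b i 0 j - a i 0 j))%:E)%E.
Proof.
move=> le_ab cover.
pose ext (c : I -> 'rV[R]_d) k :=
  oapp (c \o enum_val) 0 (insub k : option 'I_#|I|).
have extE c (k : 'I_#|I|) : ext c k = c (enum_val k) by rewrite /ext valK.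
apply: ereal_inf_lbound; exists `I_#|I|, (ext a), (ext b); split.
- by move=> k /= lt_k j; rewrite !(extE _ (Ordinal lt_k)).
- move=> x /cover[i xi]; exists (enum_rank i); first exact: ltn_ord.
  by rewrite !extE enum_rankK.
rewrite esum_fset //; last first.
  move=> k; rewrite inE /= => lt_k; rewrite lee_fin prodr_ge0 // => j _.
  by rewrite !(extE _ (Ordinal lt_k)) subr_ge0.
rewrite -fsbig_ord sumEFin; congr _%:E.
rewrite (reindex (@enum_val I predT)) /=; last first.
  by apply: onW_bij; exact: enum_val_bij.
by apply: eq_bigr => k _; rewrite !extE.
Qed.

Section Volume.
Context (R : realType) (d : nat) (V F : finType) (p : V -> 'rV[int]_d).
Context (X : smooth_fan R F p) (P : set 'rV[R]_d).
Context (F0 : (0 < #|F|)%N).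
Context (PX : forall f x, P x -> dot (fnorm X f) x <= 1).

Definition weights m : {set d.-tuple 'I_m.+1} :=
  [set t : d.-tuple 'I_m.+1 | (\sum_(i <- t) i <= m)%N].

(** The coordinates of a lattice point with respect to the facet whose cone
    contains it are natural numbers, and their sum is the value of the facet
    normal. *)
Lemma lattice_point_cone (z : 'rV[int]_d) (m : nat) :
    (forall f, dot (fnorm X f) (lattice_point z) <= m%:R) ->
  exists f, exists2 t, t \in weights m &
    lattice_point z = \sum_i (tnth t i)%:R *: lattice_point (p (fvert X f i))
      :> 'rV[R]_d.
Proof.
move=> le_m; have [f fmax] := exists_max_fnorm X (lattice_point z) F0.
have coord0 := coord_ge0_of_max fmax.
have /choice[k kE] i : exists k : nat,
    dot (fcoord X f i) (lattice_point z) = k%:R.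
  by apply/natrP; rewrite natrEint fcoord_int coord0.
have sum_k : (\sum_i k i <= m)%N.
  rewrite -(ler_nat R) natr_sum; apply: le_trans (le_m f).
  by rewrite fnorm_coord; apply: ler_sum => i _; rewrite kE.
have lt_k i : (k i < m.+1)%N.
  by rewrite ltnS (leq_trans _ sum_k) // (bigD1 i) //= leq_addr.
exists f, [tuple (inord (k i) : 'I_m.+1) | i < d].
  rewrite inE big_map big_enum /=.
  by under eq_bigr do rewrite inordK ?lt_k //.
rewrite [LHS](fcoordK X f); apply: eq_bigr => i _.
by rewrite tnth_mktuple inordK // kE.
Qed.

(** The constant [c] by which [n P] has to be enlarged in order to contain its
    points rounded down to the lattice. *)
Lemma exists_rounding_slack : exists c : nat, forall f (r : 'rV[R]_d),
  (forall j, 0 <= r 0 j <= 1) -> dot (fnorm X f) (- r) <= c%:R.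
Proof.
pose s f := \sum_j `|fnorm X f 0 j|.
have s0 f : 0 <= s f by apply: sumr_ge0 => j _; exact: normr_ge0.
have ss0 : 0 <= \sum_f s f by apply: sumr_ge0.
exists (Num.bound (\sum_f s f)) => f r r01; apply/ltW.
apply: le_lt_trans (archi_boundP ss0).
apply: (@le_trans _ _ (s f)).
  apply: ler_sum => j _; rewrite mxE mulrN -mulNr.
  have /andP[r0 r1] := r01 j.
  apply: le_trans (ler_norm _) _; rewrite normrM normrN (ger0_norm r0).
  by rewrite ler_piMr.
by rewrite (bigD1 f) //= lerDl sumr_ge0.
Qed.

(** Cover [P] by the cubes of side [1 / n] whose lowest corners are the lattice
    points found by [lattice_point_cone], scaled by [1 / n]. *)
Lemma vol_le_grid (c n : nat) : (0 < n)%N ->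
    (forall f (r : 'rV[R]_d),
      (forall j, 0 <= r 0 j <= 1) -> dot (fnorm X f) (- r) <= c%:R) ->
  (vol P <= ((#|F| * 'C(d + (n + c), d))%:R / n%:R ^+ d)%:E)%E.
Proof.
move=> n0 slack; have nR : 0 < n%:R :> R by rewrite ltr0n.
pose I := (F * {t : d.-tuple 'I_(n + c).+1 | t \in weights (n + c)})%type.
pose corner (ft : I) : 'rV[R]_d := n%:R^-1 *:
  \sum_i (tnth (val ft.2) i)%:R *: lattice_point (p (fvert X ft.1 i)).
pose b ft := corner ft + const_mx n%:R^-1.
have step ft j : b ft 0 j - corner ft 0 j = n%:R^-1.
  by rewrite /b !mxE addrC addKr.
have -> : (#|F| * 'C(d + (n + c), d))%:R / n%:R ^+ d
    = \sum_ft \prod_j (b ft 0 j - corner ft 0 j).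
  rewrite (eq_bigr (fun=> n%:R^-1 ^+ d)); last first.
    move=> ft _; rewrite (eq_bigr _ (fun j _ => step ft j)).
    by rewrite prodr_const card_ord.
  rewrite sumr_const card_prod card_sig exprVn mulr_natl.
  congr (_ *+ (_ * _)); rewrite -card_partial_ord_partitions.
  by apply: eq_card => t; rewrite !inE.
apply: vol_le_cover => [ft j|x Px].
  by rewrite -subr_ge0 step invr_ge0 ltW.
pose z := \row_j Num.floor (n%:R * x 0 j).
have floorP j : (z 0 j)%:~R <= n%:R * x 0 j < (z 0 j)%:~R + 1.
  by rewrite mxE -intrD1 floor_itv.
have le_m f : dot (fnorm X f) (lattice_point z) <= (n + c)%:R.
  pose r : 'rV[R]_d := n%:R *: x - lattice_point z.
  have -> : lattice_point z = n%:R *: x + - r :> 'rV[R]_d.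
    by rewrite opprB addrC subrK.
  rewrite dotDr dotZr natrD lerD //; first by rewrite ler_piMr ?(ltW nR) ?PX.
  by apply: slack => j; have := floorP j; rewrite !mxE; lra.
have [f [t tS zE]] := lattice_point_cone le_m.
exists (f, Sub t tS) => j; rewrite /b /corner /= -zE !mxE.
have /andP[lo hi] := floorP j.
rewrite mxE in lo hi; apply/andP; split.
  by rewrite -(ler_pM2l nR) mulrA mulfV ?gt_eqF // mul1r.
by rewrite -(ler_pM2l nR) mulrDr mulrA mulfV ?gt_eqF // mul1r ltW.
Qed.

Lemma ffact_le_exp n m : (n ^_ m <= n ^ m)%N.
Proof.
rewrite ffact_prod -[in leqRHS](card_ord m) -prod_nat_const.
by apply: leq_prod => i _; exact: leq_subr.
Qed.

Theorem factd_vol_le : ((d`!)%:R%:E * vol P <= (#|F|)%:R%:E)%E.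
Proof.
have [c slack] := exists_rounding_slack.
pose u n : R := #|F|%:R * (1 + (c + d)%:R * harmonic n) ^+ d.
have cvg_u : u @ \oo --> (#|F|%:R : R).
  rewrite -[X in _ --> X]mulr1 -[X in _ * X](expr1n _ d) -[X in X ^+ d]addr0.
  rewrite -[X in 1 + X](mulr0 (c + d)%:R); apply: cvgMr.
  apply: (@continuous_cvg _ _ _ _ _ _ (fun y : R => y ^+ d)).
    exact: exprn_continuous.
  by apply: cvgD; [exact: cvg_cst | apply: cvgMr; exact: cvg_harmonic].
have le_u n : ((d`!)%:R%:E * vol P <= (u n)%:E)%E.
  apply: le_trans (lee_wpmul2l _ (vol_le_grid (ltn0Sn n) slack)) _.
    by rewrite lee_fin ler0n.
  rewrite -EFinM lee_fin /u /harmonic.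
  have nR : 0 < n.+1%:R :> R by rewrite ltr0n.
  rewrite mulrA ler_pdivrMr ?exprn_gt0 // -mulrA -exprMn mulrDl mul1r.
  rewrite mulrAC -mulrA mulfV ?gt_eqF // mulr1 -natrD -natrX -!natrM ler_nat.
  rewrite mulnCA leq_mul2l; apply/orP; right.
  rewrite mulnC bin_ffact (leq_trans (ffact_le_exp _ _)) //.
  by rewrite eq_leq //; congr expn; lia.
case: (_ * _)%E le_u => [v|/(_ 0%N)|_]; [|by []|exact: leNye].
move=> le_u; rewrite lee_fin; apply: (cvgr_to_ge cvg_u).
by apply: nearW => n; have := le_u n; rewrite lee_fin.
Qed.

End Volume.

(** * Growth of the binomial coefficients *)

Lemma bin5_rec k :
  ('C(5 * k.+1, k.+1)
     * (4 * k.+1 * (4 * k + 3) * (4 * k + 2) * (4 * k + 1)) =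
   'C(5 * k, k)
     * (5 * (5 * k + 4) * (5 * k + 3) * (5 * k + 2) * (5 * k + 1)))%N.
Proof.
have fact_gt : (0 < k.+1 * (k`! * (4 * k)`!))%N by rewrite !muln_gt0 !fact_gt0.
apply/eqP; rewrite -(eqn_pmul2r fact_gt); apply/eqP.
have := @bin_fact (5 * k) k; have := @bin_fact (5 * k.+1) k.+1.
rewrite (_ : 5 * k - k = 4 * k)%N; last by lia.
rewrite (_ : 5 * k.+1 - k.+1 = (4 * k).+4)%N; last by lia.
rewrite [in (5 * k.+1)`!](_ : 5 * k.+1 = (5 * k).+4.+1)%N; last by lia.
rewrite !factS => /(_ _)/[swap]/(_ _) H1 H2.
have {}H1 := H1 ltac:(lia); have {}H2 := H2 ltac:(lia).
move: H2; rewrite -{}H1 => H2.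
transitivity ('C(5 * k.+1, k.+1) * (k.+1 * k`! *
  ((4 * k).+4 * ((4 * k).+3 * ((4 * k).+2 * ((4 * k).+1 * (4 * k)`!))))))%N.
  by rewrite !mulnS; ring.
by rewrite H2; ring.
Qed.

Section Asymptotics.
Context (R : realType).
Local Notation c := (5 ^+ 5 / 4 ^+ 4 : R).

(** The induction step of [bin5_bounds], for [a = 'C(5x, x)] and [e = c^x].  The
    ratio of consecutive binomial coefficients is [c (1 - 1/(2x) + O(x^-2))],
    which stays between the ratio [c] of the upper bounds and the ratio
    [c (2x + 1) / (2x + 3)] of the lower bounds. *)
Lemma bin5_step (x a a' e : R) :
    0 <= x -> 0 <= a -> a <= e -> e <= (2 * x + 1) * a ->
    a' * (4 * (x + 1) * (4 * x + 3) * (4 * x + 2) * (4 * x + 1)) =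
    a * (5 * (5 * x + 4) * (5 * x + 3) * (5 * x + 2) * (5 * x + 1)) ->
  a' <= c * e /\ c * e <= (2 * (x + 1) + 1) * a'.
Proof.
move=> x0 a0 up lo rec.
pose q := 4 * (x + 1) * (4 * x + 3) * (4 * x + 2) * (4 * x + 1).
pose r := 5 * (5 * x + 4) * (5 * x + 3) * (5 * x + 2) * (5 * x + 1).
have q0 : 0 < q by rewrite /q !mulr_gt0 //; lra.
have pos n : 0 <= x ^+ n by rewrite exprn_ge0.
have up_qr : r <= c * q.
  by rewrite /q /r; have := pos 2; have := pos 3; have := pos 4; lra.
have lo_qr : c * (2 * x + 1) * q <= (2 * (x + 1) + 1) * r.
  by rewrite /q /r; have := pos 2; have := pos 3; have := pos 4;
     have := pos 5; lra.
have r0 : 0 <= r by rewrite /r !mulr_ge0 //; lra.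
rewrite -/q -/r in rec; split; rewrite -(ler_pM2r q0).
  have -> : c * e * q = e * (c * q) by ring.
  by rewrite rec ler_pM.
have -> : (2 * (x + 1) + 1) * a' * q = a * ((2 * (x + 1) + 1) * r).
  by rewrite -mulrA rec; ring.
apply: le_trans (ler_wpM2l a0 lo_qr).
have -> : a * (c * (2 * x + 1) * q) = c * ((2 * x + 1) * a) * q by ring.
by rewrite ler_pM2r // ler_pM2l //; lra.
Qed.

Lemma bin5_bounds k :
  ('C(5 * k, k))%:R <= c ^+ k /\ c ^+ k <= (2 * k%:R + 1) * ('C(5 * k, k))%:R.
Proof.
elim: k => [|k [up lo]]; first by rewrite muln0 bin0 !expr0 mulr1; lra.
rewrite exprS -(natr1 k); apply: bin5_step up lo _ => //.
have /eqP := bin5_rec k; rewrite -(eqr_nat R) => /eqP.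
(* The binomials are generalized lest the rewriting rules unfold them. *)
move: 'C(5 * k.+1, k.+1) 'C(5 * k, k) => a' a.
by rewrite !(natrM, natrD) -(natr1 k).
Qed.

(** This passes from even to odd [d]; the factor [3] is at most
    [sqrt (5^5/4^4)]. *)
Lemma bin_5k2 k : ('C(5 * k, k) <= 'C(5 * k + 2, k) <= 3 * 'C(5 * k, k))%N.
Proof.
apply/andP; split; first by apply: leq_bin2l; rewrite leq_addr.
have h1 := mul_bin_down (5 * k + 2) k; have h2 := mul_bin_down (5 * k + 1) k.
rewrite !addnS addn0 /= in h1 h2 *.
have e1 : ((5 * k).+2 - k = 4 * k + 2)%N by lia.
have e2 : ((5 * k).+1 - k = 4 * k + 1)%N by lia.
rewrite e1 in h1; rewrite e2 in h2.
rewrite -(@leq_pmul2l ((4 * k + 2) * (4 * k + 1))); last by rewrite addn1 addn2.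
have -> : ((4 * k + 2) * (4 * k + 1) * 'C((5 * k).+2, k) =
  (5 * k).+2 * (5 * k).+1 * 'C(5 * k, k))%N.
  by rewrite -mulnA mulnCA -h1 mulnCA -h2; ring.
by rewrite mulnA leq_mul2r; apply/orP; right; nia.
Qed.

Local Notation u := (fun d : nat => (2 * 'C((5 * d) %/ 2, 2 * d))%:R : R).
Local Notation v := (fun d : nat => 2 * c `^ (d%:R / 2)).

Lemma bin52_bounds d : u d <= v d /\ v d <= 4 * d.+1%:R * u d.
Proof.
pose k := d./2; pose b := odd d.
have c0 : 0 <= c by lra.
have vE : c `^ (d%:R / 2) = c ^+ k * Num.sqrt c ^+ b.
  have -> : d%:R / 2 = k%:R + b%:R / 2 :> R.
    rewrite -[in LHS](odd_double_half d) natrD -muln2 natrM -/k -/b; lra.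
  rewrite powRD; last by apply/implyP => _; apply/eqP; lra.
  rewrite powR_mulrn //; case: b => /=; last by rewrite mul0r powRr0 expr0.
  by rewrite mul1r powR12_sqrt.
have uE : ('C((5 * d) %/ 2, 2 * d) = 'C(5 * k + b.*2, k))%N.
  have -> : (5 * d %/ 2 = 5 * k + b.*2)%N.
    by have := odd_double_half d; rewrite -/k -/b; lia.
  rewrite -[in RHS]bin_sub; last by lia.
  by congr 'C(_, _); have := odd_double_half d; rewrite -/k -/b; lia.
have kd : 2 * k%:R + 1 <= d.+1%:R :> R.
  rewrite -natrM natr1 ler_nat; have := odd_double_half d; rewrite -/k; lia.
have [up lo] := bin5_bounds k; have /andP[lo2 up2] := bin_5k2 k.
have sqrt3 : 3 <= Num.sqrt c.
  by rewrite -[3]ger0_norm // -sqrtr_sqr ler_sqrt //; lra.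
have sqrt4 : Num.sqrt c <= 4.
  by rewrite -[leRHS]ger0_norm // -[leRHS]sqrtr_sqr ler_sqrt //; lra.
rewrite vE uE natrM; move: up2 lo2; rewrite -(ler_nat R) -(ler_nat R) natrM.
have e0 : 0 <= c ^+ k by rewrite exprn_ge0.
have eDA : c ^+ k <= d.+1%:R * ('C(5 * k, k))%:R.
  by apply: le_trans lo _; rewrite ler_wpM2r.
have es3 : 3 * c ^+ k <= c ^+ k * Num.sqrt c by rewrite mulrC ler_wpM2l.
have es4 : c ^+ k * Num.sqrt c <= c ^+ k * 4 by rewrite ler_wpM2l.
move=> up2 lo2; have DAB := ler_wpM2l (ler0n R d.+1) lo2.
have D0 : 0 <= d.+1%:R * ('C(5 * k, k))%:R :> R by rewrite mulr_ge0.
case: (b) => /=; last by rewrite addn0 expr0 mulr1; split; lra.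
by rewrite expr1; split; lra.
Qed.

(** The quotient [x] satisfies [(9 d)^-1 <= x <= 1], and [ln (9 d) / d] is
    at most [6 / sqrt d]. *)
Lemma bin52_approx : approx_exp u v.
Proof.
rewrite /approx_exp -cvg_shiftS /=.
apply: (@squeeze_cvgr _ _ _ _
  (fun n => 1 - 6 * Num.sqrt (harmonic n)) (fun=> 1)).
- apply: nearW => n; pose D : R := n.+1%:R.
  have D0 : 0 < D by rewrite ltr0n.
  have D1 : 1 <= D by rewrite ler1n.
  have [uv vu] := bin52_bounds n.+1.
  have v0 : 0 < v n.+1 by rewrite mulr_gt0 // powR_gt0 //; lra.
  set x : R := u n.+1 / v n.+1.
  have x1 : x <= 1 by rewrite ler_pdivrMr // mul1r.
  have lo : (9 * D)^-1 <= x.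
    rewrite ler_pdivlMr // mulrC ler_pdivrMr; last by lra.
    apply: le_trans vu _; rewrite mulrC ler_wpM2l ?ler0n //.
    by rewrite -natr1 -/D; lra.
  have x0 : 0 < x by apply: lt_le_trans lo; rewrite invr_gt0; lra.
  have DV0 : 0 <= D^-1 by rewrite invr_ge0 ltW.
  rewrite /powR gt_eqF // -/D; apply/andP; split; last first.
    by rewrite -[leRHS]expR0 ler_expR mulr_ge0_le0 // ln_le0.
  apply: le_trans (expR_ge1Dx _); rewrite lerD2l.
  pose t := Num.sqrt D; have t0 : 0 < t by rewrite sqrtr_gt0.
  have tD : t ^+ 2 = D by rewrite sqr_sqrtr // ltW.
  have ln_lo : - (6 * t) <= ln x.
    have pos : 0 < 3 * t by rewrite mulr_gt0.
    apply: (@le_trans _ _ (ln (9 * D)^-1)); last first.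
      by rewrite ler_ln ?posrE // invr_gt0; lra.
    rewrite lnV; last by rewrite posrE; lra.
    have -> : 9 * D = (3 * t) ^+ 2 by rewrite -tD; ring.
    rewrite lnXn // lerN2; have := ln_sublinear pos; lra.
  apply: le_trans (ler_wpM2l DV0 ln_lo).
  rewrite /harmonic -/D sqrtrV ?(ltW D0) // -/t -tD mulrN lerN2.
  by rewrite (_ : t ^- 2 * (6 * t) = 6 / t) //; field; rewrite gt_eqF.
- rewrite -[X in _ --> X]subr0 -(mulr0 6) -sqrtr0.
  apply: cvgB; first exact: cvg_cst.
  apply: cvgMr; apply: (@continuous_cvg _ _ _ _ _ _ (@Num.sqrt R)).
    exact: sqrt_continuous.
  exact: cvg_harmonic.
- exact: cvg_cst.
Qed.

End Asymptotics.

(** * The bound *)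

Theorem corollary1p9 (R : realType) :
  (forall (d : nat) (P : set 'rV[R]_d), smooth_Fano_polytope P ->
     ((d`!)%:R%:E * vol P <= (2 * 'C((5 * d) %/ 2, 2 * d))%:R%:E)%E) /\
  approx_exp (fun d : nat => (2 * 'C((5 * d) %/ 2, 2 * d))%:R : R)
             (fun d : nat => 2 * (5 ^+ 5 / 4 ^+ 4) `^ (d%:R / 2)).
Proof.
split=> [d P /fan_of_smooth_Fano[V [F [p [X [F0 PX]]]]]|]; last first.
  exact: bin52_approx.
apply: le_trans (factd_vol_le F0 PX) _.
by rewrite lee_fin ler_nat; exact: card_facets_le X.
Qed.
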